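(* Let $(\Omega,d)$ be a complete metric space equipped with an average $A_\omega$. Let $S_2$ be a subdivision scheme defined on $\Omega^{\mathbb{Z}}$ relative to parameter sequences $\{T^k\}_{k=0,1,2,\ldots}$, and let $\mathcal{D}\subset\Omega^{\mathbb{Z}}$ be a set of sequences $P$ with $\delta(P)<\infty$ in which $S_2$ has a contractivity factor $\mu\in(0,1)$ and a contractivity level $L\in\mathbb{N}$. Let $S_1$ be a subdivision scheme defined on $\Omega$ satisfying: 1. $S_1$ is defined relative to the same parameter sequences $\{T^k\}_{k=0,1,2,\ldots}$ as $S_2$. 2. For all $P\in\mathcal{D}$, $S_1(P)\in\mathcal{D}$. 3. $S_1^L$ is in proximity of the second type of order $m=0$ to $S_2^L$ in $\mathcal{D}$. 4. $S_1$ is displacement-safe in $\mathcal{D}$. Then $S_1$ converges to a continuous limit curve from any $P\in\mathcal{D}$.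
   Context: **Average.** An average on $(\Omega,d)$ is a family of maps $A_\omega:\Omega\times\Omega\to\Omega$, $\omega\in[0,1]$, such that for all $x,y\in\Omega$: (i) $\omega\mapsto A_\omega(x,y)$ is continuous on $[0,1]$; (ii) $A_0(x,y)=x$, $A_1(x,y)=y$; (iii) $A_\omega(x,x)=x$; (iv) $A_\omega(x,y)=A_{1-\omega}(y,x)$; (v) $\max\{d(x,A_\omega(x,y)),d(y,A_\omega(x,y))\}\le d(x,y)$. **Subdivision scheme.** A binary refinement operator is a map $S:\Omega^{\mathbb{Z}}\to\Omega^{\mathbb{Z}}$ that is local: there is $M_S\in\mathbb{N}$ such that for all $j\in\mathbb{Z}$, $S(P)_{2j}$ and $S(P)_{2j+1}$ do not depend on $P_\ell$ for $\ell<j-M_S$ or $\ell>j+M_S$. A subdivision scheme is the repeated application $P^k=S(P^{k-1})$, $k\in\mathbb{N}$, where $P^k$ is associated with a parameter sequence $T^k=\{t_j^k\}_{j\in\mathbb{Z}}$, which is either the primal one, $t_j^k=j2^{-k}$, or the dual one, $t_j^k=j2^{-k}+\sum_{\ell=2}^{k+1}2^{-\ell}$ (empty sum for $k=0$). **Convergence.** For $Q=\{(t_j,p_j)\}_{j\in\mathbb{Z}}$ the piecewise average interpolant is $\mathcal{PA}(A_\omega,Q;t)=A_{\omega}(p_j,p_{j+1})$ with $\omega=\frac{t-t_j}{t_{j+1}-t_j}$ for $t\in[t_j,t_{j+1}]$. A scheme $S_1$ converges from $P$ to $Q^\infty:\mathbb{R}\to\Omega$ if the interpolants $f^k(t)=\mathcal{PA}(A_\omega,\{(t_j^k,S_1^k(P)_j)\}_{j\in\mathbb{Z}};t)$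 converge to $Q^\infty$ uniformly on $\mathbb{R}$, i.e. $\sup_{t\in\mathbb{R}}d(f^k(t),Q^\infty(t))\to0$. **Other notions.** $\delta(P)=\sup_{j\in\mathbb{Z}}d(p_j,p_{j+1})$ for $P=\{p_j\}$. $S_2$ has contractivity factor $\mu\in(0,1)$ and contractivity level $L\in\mathbb{N}$ in $\mathcal{D}$ if $\delta(S_2^L(P))\le\mu\,\delta(P)$ for all $P\in\mathcal{D}$. $S_1$ is displacement-safe in $\mathcal{D}$ if there is a constant $C_{S_1}\ge0$, independent of $P$, such that $d(S_1(P)_{2j},p_j)\le C_{S_1}\delta(P)$ for all $j\in\mathbb{Z}$, $P\in\mathcal{D}$. **Second-type proximity.** $S_1^L$ is in proximity of the second type of order $m$ to $S_2^L$ in $\mathcal{D}$ if there is a factor $\eta$ with $0<\eta<(1/2)^m$, independent of $P$ and $j$, such that for every $P\in\mathcal{D}$ there is a constant $E>0$ (which may depend on $P$ but not on $j$) with $$\sup_{i\in\mathbb{Z}}d\bigl(S_1^L(S_1^{jL}(P))_i,\,S_2^L(S_1^{jL}(P))_i\bigr)\le E\,\eta^{j+1},\qquad j=0,1,2,\ldots$$ *)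

(* Defs.v *)
From HB Require Import structures.
From mathcomp Require Import all_boot all_order all_algebra.
From mathcomp Require Import all_classical all_reals all_analysis.

Set Implicit Arguments.
Unset Strict Implicit.
Unset Printing Implicit Defensive.

Import Order.TTheory GRing.Theory Num.Theory.
Import numFieldNormedType.Exports.

Local Open Scope classical_set_scope.
Local Open Scope ring_scope.

(* Complete carries a base point, so these are the nonempty complete metric
   spaces. *)
#[short(type="completeMetricType")]
HB.structure Definition CompleteMetric (K : numDomainType) :=
  {T of Metric K T & Complete T}.

(* The family is indexed by w in [0, 1]; values of A outside are unconstrained. *)
Record is_average (R : realType) (T : metricType R) (A : R -> T -> T -> T) :
    Prop := IsAverage {
  average_continuous : forall x y, {within `[0, 1], continuous (fun w => A w x y)} ;
  average0 : forall x y, A 0 x y = x ;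
  average1 : forall x y, A 1 x y = y ;
  averagexx : forall (w : R) x, 0 <= w <= 1 -> A w x x = x ;
  average_sym : forall (w : R) x y, 0 <= w <= 1 -> A w x y = A (1 - w) y x ;
  average_bound : forall (w : R) x y, 0 <= w <= 1 ->
    Num.max (mdist x (A w x y)) (mdist y (A w x y)) <= mdist x y
}.

Definition is_local (T : Type) (S : (int -> T) -> int -> T) :=
  exists M : nat, forall (j : int) (P P' : int -> T),
    (forall l : int, j - M%:Z <= l <= j + M%:Z -> P l = P' l) ->
    S P (2 * j) = S P' (2 * j) /\ S P (2 * j + 1) = S P' (2 * j + 1).

Definition primal_params (R : realType) (k : nat) (j : int) : R :=
  j%:~R * 2 ^- k.

Definition dual_params (R : realType) (k : nat) (j : int) : R :=
  j%:~R * 2 ^- k + \sum_(2 <= l < k.+2) 2 ^- l.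

Record subdivision_scheme (R : realType) (T : Type) := SubdivisionScheme {
  refine :> (int -> T) -> int -> T ;
  refine_local : is_local refine ;
  params : nat -> int -> R ;
  paramsP : params = @primal_params R \/ params = @dual_params R
}.

(* When t is a common endpoint of two of the intervals, both admissible choices
   of j give the same point, because A_0(x, y) = x and A_1(x, y) = y. *)
Definition PA (R : realType) (T : Type) (A : R -> T -> T -> T)
    (tt : int -> R) (p : int -> T) (t : R) : T :=
  let j := xget 0 [set j : int | tt j <= t <= tt (j + 1)] in
  A ((t - tt j) / (tt (j + 1) - tt j)) (p j) (p (j + 1)).

Definition converges_from (R : realType) (T : metricType R)
    (A : R -> T -> T -> T) (S : subdivision_scheme R T) (P : int -> T)
    (Q : R -> T) :=
  (fun k : nat => ereal_sup (range (fun t : R =>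
     (mdist (PA A (params S k) (iter k S P) t) (Q t))%:E))) @ \oo --> 0%E.

Definition delta (R : realType) (T : metricType R) (P : int -> T) : \bar R :=
  ereal_sup (range (fun j : int => (mdist (P j) (P (j + 1)))%:E)).

Definition contractive (R : realType) (T : metricType R)
    (S : (int -> T) -> int -> T) (D : set (int -> T)) (mu : R) (L : nat) :=
  [/\ 0 < mu < 1, (0 < L)%N &
    forall P, D P -> (delta (iter L S P) <= mu%:E * delta P)%E].

Definition displacement_safe (R : realType) (T : metricType R)
    (S : (int -> T) -> int -> T) (D : set (int -> T)) :=
  exists2 C : R, 0 <= C & forall P, D P -> forall j : int,
    ((mdist (S P (2 * j)) (P j))%:E <= C%:E * delta P)%E.

Definition second_type_proximity (R : realType) (T : metricType R)
    (m L : nat) (S1 S2 : (int -> T) -> int -> T) (D : set (int -> T)) :=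
  exists2 eta : R, 0 < eta < (1 / 2) ^+ m &
    forall P, D P -> exists2 E : R, 0 < E & forall j : nat,
      (ereal_sup (range (fun i : int =>
         (mdist (iter L S1 (iter (j * L)%N S1 P) i)
                (iter L S2 (iter (j * L)%N S1 P) i))%:E))
       <= (E * eta ^+ j.+1)%:E)%E.

(* Main.v *)
Require Import Defs.
From HB Require Import structures.
From mathcomp Require Import all_boot all_order all_algebra.
From mathcomp Require Import all_classical all_reals all_analysis.
From mathcomp Require Import ring lra zify.

Import Order.TTheory GRing.Theory Num.Theory.
Import numFieldNormedType.Exports.

Local Open Scope classical_set_scope.
Local Open Scope ring_scope.

(** Write [P^k = S1^k P] and [f^k] for its piecewise average interpolant.

    The first point is that the gaps of [P^k] decay geometrically in [k].
    Applying [S2^L] to any sequence of [D] multiplies its largest gap by at most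
    [mu], and replacing [S2^L] by [S1^L] moves the two ends of each gap by the
    proximity error, so [b j = delta (P^(jL))] satisfies
    [b (j+1) <= mu * b j + 2 * E * eta ^ (j+1)] with [mu, eta < 1]
    ([perturbed_recurrence]).  This only controls the levels [k = jL]; for the
    levels [k = jL + r] the same argument runs from [S1^r P], which is again in
    [D], with its own constant [E].  Gluing the [L] residue classes gives
    [delta (P^k) <= K * rho ^ k] with [0 < rho < 1] ([delta_decay]).

    Next, [f^k] and [f^(k+1)] are uniformly close.  By the bound on averages,
    [f^k t] is within [delta (P^k)] of the left control point [P^k_j] of the cell
    containing [t]; displacement-safety moves [P^k_j] to [P^(k+1)_(2j)] at cost
    [C * delta (P^k)]; and the level-[k+1] cell containing [t] has index within
    [2] of [2j], for primal and dual parameters alike ([cell_refine]).  The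
    distance is thus at most [(C + 4) * K * rho ^ k], and completeness yields a
    limit [Q] with a geometric rate that is uniform in [t] ([geometric_limit]).

    Continuity of [Q] is obtained without continuity of the [f^k]: parameters
    closer than [2 ^- k] lie in equal or adjacent level-[k] cells ([cell_close]),
    so [f^k] varies by at most [3 * delta (P^k)] between them.  This oscillation
    and the distance from [f^k] to [Q] both tend to [0], which makes [Q]
    continuous, even uniformly. *)

(** * Gaps of control sequences *)

Lemma mdistC {R : realType} {T : metricType R} (x y : T) :
  mdist x y = mdist y x.
Proof. exact: metric_sym. Qed.

Lemma mdist_tri {R : realType} {T : metricType R} (y x z : T) :
  mdist x z <= mdist x y + mdist y z.
Proof. exact: metric_triangle. Qed.

(** The passage from extended-real suprema to real inequalities, which can then
    be combined with the triangle inequality. *)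
Lemma delta_leP {R : realType} {T : metricType R} (P : int -> T) (d : R) :
  (delta P <= d%:E)%E <-> forall j, mdist (P j) (P (j + 1)) <= d.
Proof.
split=> [Pd j|Pd].
  rewrite -lee_fin; apply: le_trans Pd.
  by apply: ereal_sup_ubound; exists j.
by apply: ge_ereal_sup => _ [j _ <-]; rewrite lee_fin.
Qed.

Lemma delta_fin {R : realType} {T : metricType R} (P : int -> T) :
  (delta P < +oo)%E -> delta P = (fine (delta P))%:E.
Proof.
move=> Poo; rewrite fineK// ge0_fin_numE//.
apply: (@le_trans _ _ (mdist (P 0) (P (0 + 1)))%:E).
  by rewrite lee_fin mdist_ge0.
by apply: ereal_sup_ubound; exists 0.
Qed.

Lemma mdist_index_le {R : realType} {T : metricType R} (P : int -> T) (d : R)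
    (n : nat) (i j : int) :
  (forall l, mdist (P l) (P (l + 1)) <= d) -> `|i - j| <= n%:Z ->
  mdist (P i) (P j) <= n%:R * d.
Proof.
move=> Pd; have d0 : 0 <= d by apply: le_trans (Pd 0); exact: mdist_ge0.
have up m l : mdist (P l) (P (l + m%:Z)) <= m%:R * d.
  elim: m => [|m IH]; first by rewrite addr0 mdistxx mul0r.
  apply: le_trans (mdist_tri (P (l + m%:Z)) _ _) _.
  rewrite -natr1 mulrDl mul1r lerD//.
  have := Pd (l + m%:Z).
  by rewrite -addrA -[in (m%:Z + 1)]natz -[X in _%:R + X]/(1%:R) -natrD addn1 natz.
move=> ijn.
have [m mn [E|E]] : exists2 m : nat, (m <= n)%N & i = j + m%:Z \/ j = i + m%:Z.
- exists `|i - j|%N; first by lia.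
  by have [|] := leP i j; [right|left]; lia.
- rewrite mdistC E; apply: le_trans (up _ _) _.
  by rewrite ler_wpM2r// ler_nat.
- by rewrite E; apply: le_trans (up _ _) _; rewrite ler_wpM2r// ler_nat.
Qed.

(** * Geometric decay of the gaps *)

(** The inhomogeneous term decays at least as fast as [q ^ j], and [q] strictly
    exceeds the contraction rate [mu]; the slack [q - mu] absorbs the
    perturbation once the constant is at least [F / (q - mu)]. *)
Lemma perturbed_recurrence {R : realType} (b : nat -> R) (mu eta F q : R) :
  0 <= mu -> 0 <= eta <= q -> mu < q < 1 -> 0 <= F ->
  (forall j, b j.+1 <= mu * b j + F * eta ^+ j.+1) ->
  exists B, forall j, b j <= B * q ^+ j.
Proof.
move=> mu0 /andP[eta0 etaq] /andP[muq q1] F0 bS.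
have q0 : 0 < q by apply: le_lt_trans muq.
exists (Num.max (b 0%N) (F / (q - mu))); set B := Num.max _ _.
have FB : F <= B * (q - mu).
  by rewrite -ler_pdivrMr ?subr_gt0// /B le_max lexx orbT.
elim=> [|j IH]; first by rewrite expr0 mulr1 /B le_max lexx.
apply: (le_trans (bS j)).
apply: (@le_trans _ _ (mu * (B * q ^+ j) + F * q ^+ j)).
  rewrite lerD ?ler_wpM2l//.
  apply: (@le_trans _ _ (q ^+ j.+1)); first by rewrite lerXn2r// nnegrE// ltW.
  by rewrite exprS ler_piMl ?exprn_ge0 ?ltW.
have : F * q ^+ j <= B * (q - mu) * q ^+ j by rewrite ler_wpM2r// exprn_ge0// ltW.
rewrite exprS; nra.
Qed.

(** Turns decay by a factor [q] every [L] levels into a rate per level. *)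
Lemma geometric_root {R : realType} (q : R) (L : nat) :
  0 < q < 1 -> (0 < L)%N -> exists2 rho, 0 < rho < 1 & rho ^+ L = q.
Proof.
move=> /andP[q0 q1] L0.
have E : (q `^ L%:R^-1) ^+ L = q.
  by rewrite -powR_mulrn ?powR_ge0// -powRrM mulVf ?powRr1 ?ltW// pnatr_eq0 -lt0n.
exists (q `^ L%:R^-1) => //; rewrite powR_gt0//=.
rewrite ltNge; apply/negP => /(exprn_ege1 L).
by rewrite E leNgt q1.
Qed.

Lemma iter_stable {T : Type} {S : T -> T} {D : set T} (k : nat) {P : T} :
  (forall P, D P -> D (S P)) -> D P -> D (iter k S P).
Proof. by move=> DS DP; elim: k => //= k; exact: DS. Qed.

(** Each gap of [S1^L P] is compared with the corresponding gap of [S2^L P],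
    which is contracted; the factor [2] accounts for the two ends of the gap. *)
Lemma proximity_step {R : realType} {T : metricType R}
    {S1 S2 : (int -> T) -> int -> T} {D : set (int -> T)} {mu : R} {L : nat} :
  (forall P, D P -> (delta P < +oo)%E) ->
  (forall P, D P -> D (S1 P)) ->
  contractive S2 D mu L -> forall P e, D P ->
  (ereal_sup (range (fun i : int =>
     (mdist (iter L S1 P i) (iter L S2 P i))%:E)) <= e%:E)%E ->
  fine (delta (iter L S1 P)) <= mu * fine (delta P) + 2 * e.
Proof.
move=> Dfin DS [_ _ S2c] P e DP Pe.
have {}Pe i : mdist (iter L S1 P i) (iter L S2 P i) <= e.
  rewrite -lee_fin; apply: le_trans Pe.
  by apply: ereal_sup_ubound; exists i.
have := S2c _ DP; rewrite (delta_fin _ (Dfin _ DP)) -EFinM => /delta_leP {}S2c.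
rewrite -lee_fin -(delta_fin (iter L S1 P)); last exact: Dfin _ (iter_stable _ DS DP).
apply/delta_leP => j.
have := Pe j; have := Pe (j + 1); have := S2c j; rewrite /=.
have := mdist_tri (iter L S2 P j) (iter L S1 P j) (iter L S1 P (j + 1)).
have := mdist_tri (iter L S2 P (j + 1)) (iter L S2 P j) (iter L S1 P (j + 1)).
rewrite (mdistC (iter L S2 P (j + 1))); lra.
Qed.

(** Contractivity and proximity compare only levels that are [L] apart, so each
    residue class of levels modulo [L] is treated as the orbit under [S1^L] of
    its own starting sequence [S1^r P]; there are finitely many classes, hence
    a common constant. *)
Lemma delta_decay {R : realType} {T : metricType R}
    {S1 S2 : (int -> T) -> int -> T} {D : set (int -> T)} {mu : R} {L : nat} :
  (forall P, D P -> (delta P < +oo)%E) ->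
  (forall P, D P -> D (S1 P)) ->
  contractive S2 D mu L -> second_type_proximity 0 L S1 S2 D ->
  forall P, D P -> exists K rho, 0 < rho < 1 /\
    forall k, fine (delta (iter k S1 P)) <= K * rho ^+ k.
Proof.
move=> Dfin DS S2c [eta /andP[eta0 eta1] prox] P DP.
have [/andP[mu0 mu1] L0 _] := S2c.
rewrite expr0 in eta1.
(* Midpoint between 1 and both rates: strict room above mu is needed. *)
pose q := (1 + Num.max mu eta) / 2.
have [muq etaq q1] : [/\ mu < q, eta < q & q < 1].
  by rewrite /q; case: (leP mu eta) => ?; split; lra.
have q0 : 0 < q by apply: lt_trans muq.
have [//|rho rho01 rhoL] := geometric_root q L _ L0; first by rewrite q0.
have /andP[rho0 rho1] := rho01.
pose a k := fine (delta (iter k S1 P)).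
have class r : exists C, forall j, a (j * L + r)%N <= C * rho ^+ (j * L + r).
  have DPr : D (iter r S1 P) by exact: iter_stable.
  have [E E0 PE] := prox _ DPr.
  have [||||j|B Bq] :=
    @perturbed_recurrence R (fun j => a (j * L + r)%N) mu eta (2 * E) q.
  - exact: ltW.
  - by rewrite !ltW.
  - by rewrite muq.
  - lra.
  - have := proximity_step Dfin DS S2c _ _ (iter_stable (j * L) DS DPr) (PE j).
    by rewrite -!iterD -mulrA -mulSn.
  exists (B / rho ^+ r) => j; apply: le_trans (Bq j) _.
  rewrite exprD mulnC exprM rhoL mulrCA mulrC -!mulrA.
  by rewrite mulVf ?mulr1 ?expf_neq0 ?gt_eqF// mulrC.
(* The truncation at 0 makes each constant at most the sum of all of them. *)
pose C r := Num.max 0 (sval (cid (class r))).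
exists (\sum_(r < L) C r), rho; split=> // k.
have kL : (k %% L < L)%N by rewrite ltn_mod.
apply: (@le_trans _ _ (C (k %% L)%N * rho ^+ k)).
  rewrite {1 3}(divn_eq k L).
  apply: (le_trans (svalP (cid (class (k %% L)%N)) _)).
  by apply: ler_wpM2r; [rewrite exprn_ge0// ltW | rewrite /C le_max lexx orbT].
apply: ler_wpM2r; first by rewrite exprn_ge0// ltW.
rewrite (bigD1 (Ordinal kL))//= lerDl sumr_ge0// => i _.
by rewrite /C le_max lexx.
Qed.

(** * Parameter grids and the piecewise average interpolant *)

(** A common form for the primal and dual grids: the level-[k] grid is
    [2 ^- k * Z] translated by [s k], and refinement shifts it to the right by at
    most half of the new mesh width (not at all for primal parameters, exactly
    half for dual ones).  Later estimates use nothing else about the grids. *)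
Lemma params_shift {R : realType} {T : Type} (S : subdivision_scheme R T) :
  exists s : nat -> R, forall k,
    (forall j, params S k j = j%:~R * 2 ^- k + s k) /\
    0 <= s k.+1 - s k <= 2 ^- k.+1 / 2.
Proof.
have p2 k : 0 < 2 ^- k :> R by rewrite invr_gt0 exprn_gt0.
case: (paramsP S) => ->.
  exists (fun=> 0) => k; split=> [j|]; first by rewrite addr0.
  by rewrite subrr lexx divr_ge0// ltW.
exists (fun k => \sum_(2 <= l < k.+2) 2 ^- l) => k; split=> // .
rewrite [X in X - _]big_nat_recr//= addrAC subrr add0r ltW//=.
by rewrite [X in X^-1]exprS invfM mulrC.
Qed.

(** Existence of a cell containing [t] makes the choice in [PA] meaningful, and
    property (v) of averages keeps the value within one gap of the left control
    point of that cell. *)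
Lemma PA_near {R : realType} {T : metricType R} {A : R -> T -> T -> T} :
  is_average A -> forall (S : subdivision_scheme R T) (k : nat) (p : int -> T)
    (d t : R), (forall l, mdist (p l) (p (l + 1)) <= d) ->
  exists j, params S k j <= t <= params S k (j + 1) /\
    mdist (p j) (PA A (params S k) p t) <= d.
Proof.
move=> hA S k p d t pd; rewrite /PA.
set J := [set j : int | _].
have [j Jj] : exists j, J j.
  have [s /(_ k)[sE _]] := params_shift S.
  have p2 : 0 < 2 ^+ k :> R by rewrite exprn_gt0.
  exists (Num.floor ((t - s k) * 2 ^+ k)); rewrite /J/= !sE -lerBrDr -[t <= _]lerBlDr.
  by rewrite ler_pdivrMr// ler_pdivlMr// floor_le ltW// floorD1_gt.
have /= := @xgetPex _ 0 J (ex_intro _ j Jj).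
set i := xget 0 J => /[dup] ti /andP[t1 t2]; exists i; split=> //.
have w01 : 0 <= (t - params S k i) / (params S k (i + 1) - params S k i) <= 1.
  have [s /(_ k)[sE _]] := params_shift S.
  have lt : 0 < params S k (i + 1) - params S k i.
    rewrite !sE intrD mulrDl mul1r.
    have : 0 < 2 ^- k :> R by rewrite invr_gt0 exprn_gt0.
    lra.
  by rewrite ler_pdivrMr// mul1r lerB// andbT divr_ge0// ?subr_ge0// ltW// -subr_gt0.
have := average_bound hA (p i) (p (i + 1)) w01.
by rewrite ge_max => /andP[+ _] => /le_trans; apply.
Qed.

(** In units of the level-[k+1] mesh, a [t] in cell [j] is at offset at least
    [-1/2] and at most [2] from position [2j] of the finer grid, so the index of
    its finer cell is between [2j - 1] and [2j + 2]. *)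
Lemma cell_refine {R : realType} {T : Type} (S : subdivision_scheme R T)
    (k : nat) (t : R) (i j : int) :
  params S k j <= t <= params S k (j + 1) ->
  params S k.+1 i <= t <= params S k.+1 (i + 1) -> `|i - 2 * j| <= 2%:Z.
Proof.
have [s sP] := params_shift S.
have [sE /andP[s0 s1]] := sP k; have [sE' _] := sP k.+1.
rewrite !sE !sE'.
have p2 : 0 < 2 ^- k.+1 :> R by rewrite invr_gt0 exprn_gt0.
have -> : 2 ^- k = 2 * 2 ^- k.+1 :> R.
  by rewrite exprS invfM mulrA divff ?mul1r.
set h := 2 ^- k.+1 in p2 s1 *.
rewrite !intrD => /andP[j1 j2] /andP[i1 i2].
have ub : i%:~R <= (2 * j + 2)%:~R :> R.
  by rewrite -(ler_pM2r p2) intrD intrM; lra.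
have lb : (2 * j - 1)%:~R < (i + 1)%:~R :> R.
  by rewrite -(ltr_pM2r p2) !intrD intrM; lra.
by move: ub lb; rewrite ler_int ltr_int; lia.
Qed.

Lemma cell_close {R : realType} {T : Type} (S : subdivision_scheme R T)
    (k : nat) (t t' : R) (i j : int) : `|t - t'| < 2 ^- k ->
  params S k i <= t <= params S k (i + 1) ->
  params S k j <= t' <= params S k (j + 1) -> `|i - j| <= 1%:Z.
Proof.
have [s /(_ k)[sE _]] := params_shift S.
rewrite !sE.
have p2 : 0 < 2 ^- k :> R by rewrite invr_gt0 exprn_gt0.
set h := 2 ^- k in p2 *.
rewrite !intrD ltr_norml => /andP[tt1 tt2] /andP[i1 i2] /andP[j1 j2].
have ub : i%:~R < (j + 2)%:~R :> R by rewrite -(ltr_pM2r p2) intrD; lra.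
have lb : j%:~R < (i + 2)%:~R :> R by rewrite -(ltr_pM2r p2) intrD; lra.
by move: ub lb; rewrite !ltr_int; lia.
Qed.

(** * Limits of geometrically Cauchy sequences *)

(** The explicit rate is what makes the convergence of the interpolants uniform
    in the parameter: the bound depends only on [K] and [rho]. *)
Lemma geometric_limit {R : realType} {T : completeMetricType R}
    (f : nat -> T) (K rho : R) : 0 < rho < 1 ->
  (forall n, mdist (f n) (f n.+1) <= K * rho ^+ n) ->
  exists l, forall n, mdist (f n) l <= K / (1 - rho) * rho ^+ n.
Proof.
move=> /andP[rho0 rho1] fK.
have r1 : 0 < 1 - rho by rewrite subr_gt0.
have K0 : 0 <= K.
  by have := fK 0%N; rewrite expr0 mulr1; apply: le_trans; exact: mdist_ge0.
set M := K / (1 - rho).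
have M0 : 0 <= M by rewrite divr_ge0// ltW.
have ME : K = M * (1 - rho) by rewrite /M divfK// gt_eqF.
have far m n : (n <= m)%N -> mdist (f n) (f m) <= M * rho ^+ n.
  move=> nm; rewrite -(subnKC nm); move: (m - n)%N => {nm}{}m.
  (* The partial geometric sum, kept exact so that the induction closes. *)
  apply: (@le_trans _ _ (M * (rho ^+ n - rho ^+ (n + m)))); last first.
    by rewrite ler_wpM2l// gerBl exprn_ge0// ltW.
  elim: m => [|m IH]; first by rewrite addn0 subrr mulr0 mdistxx.
  apply: le_trans (mdist_tri (f (n + m)%N) _ _) _.
  have := fK (n + m)%N; rewrite addnS exprS ME; move: IH.
  by set x := rho ^+ (n + m); set y := rho ^+ n; nra.
have small e : 0 < e -> \forall n \near \oo, M * rho ^+ n < e.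
  move=> e0.
  have : M * rho ^+ n @[n --> \oo] --> M * 0.
    apply: cvgMr; apply: cvg_expr; by rewrite ger0_norm// ltW.
  rewrite mulr0 => /cvgrPdist_lt/(_ e e0); apply: filterS => n /=.
  by rewrite sub0r normrN ger0_norm// mulr_ge0// exprn_ge0// ltW.
have /cauchy_cvg/cvg_ex[l fl] : cauchy (f @ \oo).
  apply: cauchy_exP => e /small[N _ MN].
  exists (f N); exists N => // n /= Nn.
  rewrite ballEmdist/=; apply: le_lt_trans (far _ _ Nn) _.
  by apply: MN => /=.
exists l => n; apply/ler_addgt0Pl => e e0.
have /(_ _ e e0) := (metricType_numDomainType.cvgr_dist_lt fl).
move=> [N _ /(_ (maxn N n))]; rewrite /= leq_maxl => /(_ isT) lN.
apply: le_trans (mdist_tri (f (maxn N n)) _ _) _.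
rewrite addrC lerD//; first by rewrite mdistC ltW.
by apply: far; rewrite leq_maxr.
Qed.

(** * Convergence of the perturbed scheme *)

Theorem theorem6p3 (R : realType) (Omega : completeMetricType R)
    (A : R -> Omega -> Omega -> Omega) (hA : is_average A)
    (S2 : subdivision_scheme R Omega) (D : set (int -> Omega))
    (hD : forall P, D P -> (delta P < +oo)%E)
    (mu : R) (L : nat) (hS2 : contractive S2 D mu L)
    (S1 : subdivision_scheme R Omega)
    (hparams : params S1 = params S2)
    (hstable : forall P, D P -> D (S1 P))
    (hprox : second_type_proximity 0 L S1 S2 D)
    (hsafe : displacement_safe S1 D) :
  forall P, D P -> exists Q : R -> Omega,
    continuous Q /\ converges_from A S1 P Q.
Proof.
move=> P DP.
have [K [rho [rho01 decay]]] := delta_decay hD hstable hS2 hprox P DP.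
have /andP[rho0 rho1] := rho01.
have [C C0 safe] := hsafe.
pose p k := iter k S1 P.
pose f k t := PA A (params S1 k) (p k) t.
have Dp k : D (p k) by exact: iter_stable.
pose d k := K * rho ^+ k.
have deltad k : (delta (p k) <= (d k)%:E)%E.
  by rewrite (delta_fin _ (hD _ (Dp k))) lee_fin decay.
have gap k l : mdist (p k l) (p k (l + 1)) <= d k by move: l; exact/delta_leP.
have d0 k : 0 <= d k by apply: le_trans (gap k 0); exact: mdist_ge0.
have dS k : d k.+1 <= d k.
  by rewrite /d exprS mulrCA; apply: ler_piMl; [exact: d0 | exact: ltW].
have disp k j : mdist (p k.+1 (2 * j)) (p k j) <= C * d k.
  rewrite -lee_fin; apply: le_trans (safe _ (Dp k) j) _.
  by rewrite EFinM lee_wpmul2l// lee_fin.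
(* 1 from f^k to its control point, C for the displacement, 2 for the change
   of index, and 1 from the new control point to f^(k+1). *)
have step k t : mdist (f k t) (f k.+1 t) <= (C + 4) * d k.
  have [j [jt jf]] := PA_near hA S1 k (p k) (d k) t (gap k).
  have [i [it iF]] := PA_near hA S1 k.+1 (p k.+1) (d k.+1) t (gap k.+1).
  have ij := mdist_index_le _ _ 2 _ _ (gap k.+1) (cell_refine _ _ _ _ _ jt it).
  have := disp k j; have := dS k.
  move: jf iF ij; rewrite -/(f k t) -/(f k.+1 t).
  have := mdist_tri (p k j) (f k t) (f k.+1 t).
  have := mdist_tri (p k.+1 (2 * j)) (p k j) (f k.+1 t).
  have := mdist_tri (p k.+1 i) (p k.+1 (2 * j)) (f k.+1 t).
  rewrite (mdistC (f k t) (p k j)) (mdistC (p k j) (p k.+1 _)).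
  rewrite (mdistC (p k.+1 (2 * j)) (p k.+1 i)); lra.
have equi k t t' : `|t - t'| < 2 ^- k -> mdist (f k t) (f k t') <= 3 * d k.
  move=> tt'.
  have [j [jt jf]] := PA_near hA S1 k (p k) (d k) t (gap k).
  have [i [it iF]] := PA_near hA S1 k (p k) (d k) t' (gap k).
  have ij := mdist_index_le _ _ 1 _ _ (gap k) (cell_close _ _ _ _ _ _ tt' jt it).
  move: jf iF ij; rewrite -/(f k t) -/(f k t').
  have := mdist_tri (p k j) (f k t) (f k t').
  have := mdist_tri (p k i) (p k j) (f k t').
  rewrite (mdistC (f k t) (p k j)); lra.
pose M := (C + 4) * K / (1 - rho).
have [Q fQ] : exists Q : R -> Omega, forall t n, mdist (f n t) (Q t) <= M * rho ^+ n.
  suff /boolp.choice[Q fQ] : forall t, exists l, forall n,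
      mdist (f n t) l <= M * rho ^+ n by exists Q.
  by move=> t; apply: geometric_limit => // n; rewrite -mulrA; exact: step.
have geo B : B * rho ^+ n @[n --> \oo] --> (0 : R).
  rewrite -(mulr0 B); apply: cvgMr; apply: cvg_expr.
  by rewrite ger0_norm// ltW.
exists Q; split.
  move=> t; apply/metricType_numDomainType.cvgrPdist_lt => e e0.
  have /cvgrPdist_lt/(_ e e0)[n _ /(_ n (leqnn n))] := geo (2 * M + 3 * K).
  rewrite /= sub0r normrN => /(le_lt_trans (ler_norm _)) small.
  have : \forall t' \near t, `|t - t'| < 2 ^- n.
    by apply: nbhsx_ballx; rewrite invr_gt0 exprn_gt0.
  apply: filterS => t' /equi; have := fQ t n; have := fQ t' n; move: small.
  have := mdist_tri (f n t) (Q t) (Q t'); have := mdist_tri (f n t') (f n t) (Q t').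
  by rewrite (mdistC (Q t) (f n t)) /d; lra.
apply: (@squeeze_cvge _ _ _ _ (cst 0%E) _ (fun n => (M * rho ^+ n)%:E)).
- apply: nearW => n; apply/andP; split.
    apply: (@le_trans _ _ (mdist (f n 0) (Q 0))%:E); first by rewrite lee_fin mdist_ge0.
    by apply: ereal_sup_ubound; exists 0.
  by apply: ge_ereal_sup => _ [t _ <-]; rewrite lee_fin fQ.
- exact: cvg_cst.
- by apply: cvg_EFin; [exact: nearW | exact: geo].
Qed.
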